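(* Let $\mathcal{E}$ be a collection of spaces. If a map $f:X\to Y$ is dominated by a map $f':X'\to Y'$, then $$\mathcal{E}\text{-}\mathrm{secat}(f)\le\mathcal{E}\text{-}\mathrm{secat}(f').$$
   Context: All spaces are assumed to have the homotopy type of connected CW-complexes; spaces have no base points and maps are not required to preserve base points. A collection $\mathcal{E}$ of spaces means any collection of spaces containing the one-point space $*$. Given $f:X\to Y$, a subset $U\subseteq Y$ with inclusion $i:U\hookrightarrow Y$ is $\mathcal{E}$-section-categorical (with respect to $f$) if there are a space $E\in\mathcal{E}$ and maps $u:U\to E$, $v:E\to X$ with $fvu\simeq i$. The (reduced) $\mathcal{E}$-sectional category $\mathcal{E}\text{-}\mathrm{secat}(f)$ is the smallest integer $n\ge 0$ such that $Y$ has an open cover by $n+1$ subsets each of which is $\mathcal{E}$-section-categorical with respect to $f$ (and $\infty$ if no such $n$ exists). A map $f:X\to Y$ is dominated by $f':X'\to Y'$ if there are maps $i:X\to X'$, $j:Y\to Y'$, $r:X'\to X$, $s:Y'\to Y$ with $f'i\simeq jf$, $fr\simeq sf'$, $ri\simeq\mathrm{id}_X$ and $sj\simeq\mathrm{id}_Y$. *)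

(* Defs.v *)
From HB Require Import structures.
From mathcomp Require Import all_boot all_order all_algebra.
From mathcomp Require Import all_classical all_reals.
From mathcomp Require Import topology.

Set Implicit Arguments.
Unset Strict Implicit.
Unset Printing Implicit Defensive.

Import Order.TTheory GRing.Theory Num.Theory numFieldTopology.Exports.
Local Open Scope classical_set_scope.
Local Open Scope ring_scope.

Section Homotopy.
Variable R : realType.

Definition I01 : set R := `[0, 1].

Definition homotopic (X Y : topologicalType) (f g : X -> Y) : Prop :=
  exists2 H : X * I01 -> Y, continuous H &
    forall (x : X) (t : I01),
      (set_val t = 0 -> H (x, t) = f x) /\ (set_val t = 1 -> H (x, t) = g x).

Definition homotopy_equivalent (X Y : topologicalType) : Prop :=
  exists (f : X -> Y) (g : Y -> X),
    [/\ continuous f, continuous g,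
        homotopic (g \o f) id & homotopic (f \o g) id].

End Homotopy.

Section CW.
Variable R : realType.

Definition norm2 n (x : 'rV[R]_n) : R := \sum_(i < n) x ord0 i ^+ 2.

Definition disk n : set 'rV[R]_n := [set x | norm2 x <= 1].
Definition open_disk n : set 'rV[R]_n := [set x | norm2 x < 1].
Definition sphere n : set 'rV[R]_n := [set x | norm2 x = 1].

(* [phi c] is the characteristic map of the cell [c]: only its values on the
   disk of dimension [dim c] matter, and the open cell is the image of the
   open disk. The four clauses on cells are: each characteristic map restricts
   to a homeomorphism from the open disk onto the open cell; the open cells
   partition [K]; closure-finiteness; weak topology. *)
Definition CW_complex (K : topologicalType) : Prop :=
  hausdorff_space K /\
  exists (cell : Type) (dim : cell -> nat)
         (phi : forall c : cell, 'rV[R]_(dim c) -> K),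
    let open_cell c := phi c @` @open_disk (dim c) in
    [/\ forall c, {within @disk (dim c), continuous (phi c)},
        forall c, exists2 psi : K -> 'rV[R]_(dim c),
          {within open_cell c, continuous psi} &
          {in @open_disk (dim c), cancel (phi c) psi},
        trivIset [set: cell] open_cell /\
          \bigcup_(c in [set: cell]) open_cell c = [set: K],
        forall c, exists2 F : set cell,
          finite_set F /\ (forall c', F c' -> (dim c' < dim c)%N) &
          phi c @` @sphere (dim c) `<=` \bigcup_(c' in F) open_cell c' &
        forall A : set K,
          (forall c, closed (@disk (dim c) `&` phi c @^-1` A)) -> closed A].

(* The library's [connected] accepts the empty set. *)
Definition connected_CW_complex (K : topologicalType) : Prop :=
  [/\ CW_complex K, [set: K] !=set0 & connected [set: K]].

Definition is_space (X : topologicalType) : Prop :=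
  exists2 K : topologicalType,
    connected_CW_complex K & homotopy_equivalent R X K.

End CW.

Definition one_point_space (P : topologicalType) : Prop :=
  exists p : P, forall q : P, q = p.

Definition collection (R : realType) (E : topologicalType -> Prop) : Prop :=
  (forall T, E T -> is_space R T) /\ (exists2 P, E P & one_point_space P).

Section Secat.
Variables (R : realType) (E : topologicalType -> Prop).

Definition section_categorical (X Y : topologicalType) (f : X -> Y)
    (U : set Y) : Prop :=
  exists T : topologicalType, E T /\
    exists (u : U -> T) (v : T -> X),
      [/\ continuous u, continuous v &
          homotopic R (f \o v \o u) (set_val : U -> Y)].

Definition has_categorical_cover (X Y : topologicalType) (f : X -> Y)
    (n : nat) : Prop :=
  exists U : 'I_n.+1 -> set Y,
    [/\ forall k, open (U k),
        \bigcup_(k in [set: 'I_n.+1]) U k = [set: Y] &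
        forall k, section_categorical f (U k)].

Definition secat (X Y : topologicalType) (f : X -> Y) : \bar int :=
  match pselect (exists n, `[< has_categorical_cover f n >]) with
  | left ex_n => (Posz (ex_minn ex_n))%:E
  | right _ => +oo%E
  end.

End Secat.

Definition dominated (R : realType) (X Y X' Y' : topologicalType)
    (f : X -> Y) (f' : X' -> Y') : Prop :=
  exists (i : X -> X') (j : Y -> Y') (r : X' -> X) (s : Y' -> Y),
    [/\ continuous i, continuous j, continuous r & continuous s] /\
    [/\ homotopic R (f' \o i) (j \o f), homotopic R (f \o r) (s \o f'),
        homotopic R (r \o i) id & homotopic R (s \o j) id].

(* Main.v *)
Require Import Defs.
From mathcomp Require Import all_boot all_order all_algebra.
From mathcomp Require Import all_classical all_reals.
From mathcomp Require Import topology normedtype.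
From mathcomp Require Import lra.

Set Implicit Arguments.
Unset Strict Implicit.
Unset Printing Implicit Defensive.

Import Order.TTheory GRing.Theory Num.Theory.
Import numFieldNormedType.Exports.
Local Open Scope classical_set_scope.
Local Open Scope ring_scope.

(** Let [U] be an open set of [Y'] with maps [u : U -> T], [v : T -> X'] such
    that [f' v u] is homotopic to the inclusion of [U]. Then the open set
    [j^-1(U)] of [Y] is section-categorical for [f], with the same space [T]
    and the maps [u j] and [r v]: writing [j] also for its restriction to
    [j^-1(U)], and [inc] for the inclusion of [j^-1(U)],
      [f r v u j ~ s f' v u j ~ s j inc ~ inc].
    Pulling back along [j] each member of an open cover of [Y'] thus gives an
    open cover of [Y] with as many members ([has_categorical_cover_dominated]),
    and the inequality between the minima follows ([secat_le]).

    The chain of homotopies above needs only that homotopy is preserved by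
    composition on either side and is transitive; transitivity rests on gluing
    two continuous maps along a closed set ([continuous_glue_le]). *)

(** * Gluing and reparametrization *)

(** The two closed sets [h <= c] and [c <= h] cover the source, and on each of
    them the glued function coincides with a continuous one. *)
Lemma continuous_glue_le (R : realType) (T Y : topologicalType)
    (h : T -> R) (c : R) (F G : T -> Y) :
  continuous h -> continuous F -> continuous G ->
  (forall x, h x = c -> F x = G x) ->
  continuous (fun x => if h x <= c then F x else G x).
Proof.
move=> ch cF cG FG.
have cover : [set x | h x <= c] `|` [set x | c <= h x] = [set: T].
  by apply/seteqP; split=> // x _; exact/orP/le_total.
apply/continuous_subspace_setT; rewrite -cover; apply: withinU_continuous.
- apply: (preimage_closed (D := [set y | y <= c])); last exact: closed_le.
  by move=> ? _; exact: ch.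
- apply: (preimage_closed (D := [set y | c <= y])); last exact: closed_ge.
  by move=> ? _; exact: ch.
- apply: (@subspace_eq_continuous _ [set x | h x <= c] _ F).
    by move=> x; rewrite inE /from_subspace /= => ->.
  exact: continuous_subspaceT.
- apply: (@subspace_eq_continuous _ [set x | c <= h x] _ G).
    move=> x; rewrite inE /from_subspace /= => cx; case: ifPn => // xc.
    by rewrite FG //; apply/le_anti; rewrite xc.
  exact: continuous_subspaceT.
Qed.

Lemma continuous_pair (T A B : topologicalType) (a : T -> A) (b : T -> B) :
  continuous a -> continuous b -> continuous (fun t => (a t, b t)).
Proof. by move=> ca cb t; exact: (cvg_pair (ca t) (cb t)). Qed.

Section Clamp.
Variable R : realType.

Lemma clamp_subproof (a : R) : Num.max 0 (Num.min a 1) \in @I01 R.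
Proof.
rewrite inE /I01 /= in_itv /= le_max lexx /= ge_max ler01 /=.
by rewrite ge_min lexx orbT.
Qed.

(** The retraction of the line onto the unit interval. It gives reparametrized
    times such as [2 * t] a value in [I01] for all [t], so that both halves of
    a concatenated homotopy are defined, and continuous, at all times. *)
Definition clamp (a : R) : @I01 R := exist (fun b => b \in @I01 R) _ (clamp_subproof a).

Lemma clamp_id (a : R) : 0 <= a <= 1 -> set_val (clamp a) = a.
Proof.
by move=> /andP[a0 a1]; rewrite set_valE /= min_l // max_r.
Qed.

Lemma continuous_clamp : continuous clamp.
Proof.
have cmaxmin : continuous ((fun=> 0) \max (id \min (fun=> 1)) : R -> R).
  move=> a; apply: (@continuous_max R R); first exact: cst_continuous.
  by apply: (@continuous_min R R); [exact: cvg_id|exact: cst_continuous].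
by apply: continuous_comp_initial; exact: cmaxmin.
Qed.

End Clamp.

(** * Calculus of homotopies *)

Section HomotopyCalculus.
Variable R : realType.

Lemma homotopic_postcomp (X Y Z : topologicalType) (g : Y -> Z)
    (f0 f1 : X -> Y) :
  continuous g -> homotopic R f0 f1 -> homotopic R (g \o f0) (g \o f1).
Proof.
move=> cg [H cH H01]; exists (g \o H).
  by move=> x; apply: continuous_comp; [exact: cH|exact: cg].
by move=> x t; have [H0 H1] := H01 x t; split=> [/H0|/H1] /= ->.
Qed.

Lemma homotopic_precomp (W X Y : topologicalType) (g : W -> X)
    (f0 f1 : X -> Y) :
  continuous g -> homotopic R f0 f1 -> homotopic R (f0 \o g) (f1 \o g).
Proof.
move=> cg [H cH H01].
exists (fun wt : W * @I01 R => H (g wt.1, wt.2)); last first.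
  by move=> w t; exact: H01.
move=> wt; apply: (@continuous_comp _ _ _ (fun z => (g z.1, z.2)) H); last first.
  exact: cH.
apply: continuous_pair; last by move=> ?; exact: cvg_snd.
by move=> ?; apply: continuous_comp; [exact: cvg_fst|exact: cg].
Qed.

(** The two homotopies run one after the other at double speed; they agree with
    [g] at time 1/2. *)
Lemma homotopic_trans (X Y : topologicalType) (f g h : X -> Y) :
  homotopic R f g -> homotopic R g h -> homotopic R f h.
Proof.
move=> [F cF F01] [G cG G01].
pose time (xt : X * @I01 R) : R := set_val xt.2.
have ctime : continuous time.
  move=> xt; apply: continuous_comp; first exact: cvg_snd.
  exact: initial_continuous.
pose speedup (a : R) (H : X * @I01 R -> Y) (xt : X * @I01 R) :=
  H (xt.1, clamp (2 * time xt - a)).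
have cspeedup a H : continuous H -> continuous (speedup a H).
  move=> cH xt.
  apply: (@continuous_comp _ _ _
    (fun z => (z.1, clamp (2 * time z - a))) H); last exact: cH.
  apply: continuous_pair => [?|{}xt]; first exact: cvg_fst.
  apply: (@continuous_comp _ _ _ (fun z => 2 * time z - a) (@clamp R));
    last exact: continuous_clamp.
  apply: cvgB; last exact: cvg_cst.
  by apply: cvgM; [exact: cvg_cst|exact: ctime].
have F0 x a : a = 0 -> F (x, clamp a) = f x.
  by move=> a0; apply: (F01 x _).1; rewrite clamp_id; lra.
have F1 x a : a = 1 -> F (x, clamp a) = g x.
  by move=> a1; apply: (F01 x _).2; rewrite clamp_id; lra.
have G0 x a : a = 0 -> G (x, clamp a) = g x.
  by move=> a0; apply: (G01 x _).1; rewrite clamp_id; lra.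
have G1 x a : a = 1 -> G (x, clamp a) = h x.
  by move=> a1; apply: (G01 x _).2; rewrite clamp_id; lra.
exists (fun xt => if time xt <= 2^-1 then speedup 0 F xt else speedup 1 G xt).
  apply: continuous_glue_le => // [||xt half]; try exact: cspeedup.
  by rewrite /speedup half F1 ?G0 //; lra.
move=> x t; split=> t01; rewrite /speedup /time /= t01.
  by rewrite ifT ?F0 //; lra.
by rewrite ifF ?G1 //; lra.
Qed.

End HomotopyCalculus.

(** * Section-categorical sets under domination *)

Section Restriction.
Variables (Y Y' : topologicalType) (j : Y -> Y') (U : set Y').

Lemma restrict_preimage_subproof (y : j @^-1` U) : j (set_val y) \in U.
Proof. by rewrite inE; exact: (set_valP y). Qed.

Definition restrict_preimage (y : j @^-1` U) : U :=
  exist (fun z => z \in U) _ (restrict_preimage_subproof y).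

Lemma continuous_restrict_preimage :
  continuous j -> continuous restrict_preimage.
Proof.
move=> cj; apply: continuous_comp_initial => y.
apply: (@continuous_comp _ _ _ set_val j); last exact: cj.
exact: initial_continuous.
Qed.

End Restriction.

(** The composite [f r v u j] is deformed from the left: [f r] becomes [s f'],
    after which [f' v u] becomes the inclusion of [U], leaving [s j] restricted
    to [j^-1(U)]. *)
Lemma section_categorical_preimage (R : realType)
    (E : topologicalType -> Prop) (X Y X' Y' : topologicalType)
    (f : X -> Y) (f' : X' -> Y') (j : Y -> Y') (r : X' -> X) (s : Y' -> Y)
    (U : set Y') :
  continuous j -> continuous r -> continuous s ->
  homotopic R (f \o r) (s \o f') -> homotopic R (s \o j) id ->
  section_categorical R E f' U -> section_categorical R E f (j @^-1` U).
Proof.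
move=> cj cr cs frsf' sj [T [ET [u [v [cu cv f'vu]]]]].
pose jU := restrict_preimage (j := j) (U := U).
have cjU : continuous jU by exact: continuous_restrict_preimage.
have cujU : continuous (u \o jU).
  by move=> y; apply: continuous_comp; [exact: cjU|exact: cu].
exists T; split=> //; exists (u \o jU), (r \o v); split=> //.
  by move=> e; apply: continuous_comp; [exact: cv|exact: cr].
have cvujU : continuous (v \o (u \o jU)).
  by move=> y; apply: continuous_comp; [exact: cujU|exact: cv].
apply: (homotopic_trans (g := (s \o f') \o (v \o (u \o jU)))).
  exact: homotopic_precomp cvujU frsf'.
apply: (homotopic_trans (g := (s \o j) \o set_val)).
  exact: homotopic_postcomp cs (homotopic_precomp cjU f'vu).
apply: (homotopic_precomp _ sj); exact: initial_continuous.
Qed.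

Lemma has_categorical_cover_dominated (R : realType)
    (E : topologicalType -> Prop) (X Y X' Y' : topologicalType)
    (f : X -> Y) (f' : X' -> Y') (n : nat) :
  dominated R f f' ->
  has_categorical_cover R E f' n -> has_categorical_cover R E f n.
Proof.
move=> [i [j [r [s [[_ cj cr cs] [_ frsf' _ sj]]]]]] [U [oU covU catU]].
exists (fun k => j @^-1` U k); split=> [k||k].
- by apply: open_comp => // y _; exact: cj.
- by rewrite -preimage_bigcup covU preimage_setT.
- exact: section_categorical_preimage cj cr cs frsf' sj (catU k).
Qed.

Lemma secat_le (R : realType) (E : topologicalType -> Prop)
    (X Y X' Y' : topologicalType) (f : X -> Y) (f' : X' -> Y') :
  (forall n, has_categorical_cover R E f' n -> has_categorical_cover R E f n) ->
  (secat R E f <= secat R E f')%E.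
Proof.
move=> cover_le; rewrite /secat.
case: (pselect (exists n, `[< has_categorical_cover R E f' n >])) => [ex'|_];
  last exact: leey.
case: ex_minnP => n' /asboolP cov' _.
case: pselect => [ex|[]]; last by exists n'; exact/asboolP/cover_le.
case: ex_minnP => n _ min_n; rewrite lee_fin lez_nat.
by apply: min_n; exact/asboolP/cover_le.
Qed.

Theorem proposition3p6 (R : realType) (E : topologicalType -> Prop)
    (X Y X' Y' : topologicalType) (f : X -> Y) (f' : X' -> Y')
    (hE : collection R E)
    (hX : is_space R X) (hY : is_space R Y)
    (hX' : is_space R X') (hY' : is_space R Y')
    (hf : continuous f) (hf' : continuous f')
    (hdom : dominated R f f') :
  (secat R E f <= secat R E f')%E.
Proof.
by apply: secat_le => n; exact: has_categorical_cover_dominated.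
Qed.
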